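(* Let $R$ be a connected reduced order with degree map $d$, and suppose $(A,G),(B,H)\in\mathcal{D}(R)$ are such that $A$ and $B$ are stark. Then $A\cong B$ as rings, $G\cong H$ as groups, and $(A,G)$, $(A,H)$, $(B,G)$ and $(B,H)$ all lie in $\mathcal{D}(R)$ and are in the same $U^*(d)$-orbit of $\mathcal{D}(R)$.
   Context: All rings have a unit element. An order is a commutative ring whose additive group is isomorphic to $\mathbb{Z}^n$; reduced means no non-zero nilpotents, connected means exactly two idempotents; a commutative ring is stark if it is not isomorphic to a group ring $C[J]$ with $J$ a non-trivial group. $\mathcal{D}(R)$ is the set of pairs $(A,G)$ with $A\subset R$ a subring and $G\subset R^*$ a subgroup such that the natural map from the group ring $A[G]$ to $R$ is an isomorphism. A grading of $R$ is a pair $(\Delta,(R_\delta)_\delta)$ with $\Delta$ an abelian group and $R_\delta$ additive subgroups with $R_\gamma R_\delta\subset R_{\gamma\delta}$ and $\bigoplus_\delta R_\delta\to R$ bijective; it is universal if every grading is the pushforward $(E,(\sum_{\delta\in f^{-1}\epsilon}R_\delta)_\epsilon)$ along a unique homomorphism $f$ from its group. A reduced order has a universal grading $(\Gamma,(R_\gamma)_\gamma)$ with $\Gamma$ finite; for connected reduced $R$ each root of unity $\zeta\in\mu=\mu(R)$ lies in $R_\gamma$ for a unique $\gamma$, and the degree map $d\colon\mu\to\Gamma$, $\zeta\mapsto\gamma$, is a homomorphism. $Q(d)=\mathbb{Z}\oplus\operatorname{Hom}(\Gamma,\mu)$ is the ring with $(m,f)\star(n,g)=(mn,mg+nf+f\circ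 d\circ g)$ (Hom groups written additively); $U^*(d)=(1+\operatorname{Hom}(\Gamma,\mu))\cap Q(d)^*$. The element $1+f\in U^*(d)$ acts on $R$ by the ring automorphism $x\mapsto f(\gamma)\cdot x$ for $x\in R_\gamma$ (extended additively), and hence on $\mathcal{D}(R)$ componentwise. *)

(* Defs.v *)
From HB Require Import structures.
From mathcomp Require Import all_boot all_order all_algebra.
From Stdlib Require Import ClassicalEpsilon.
Set Implicit Arguments. Unset Strict Implicit. Unset Printing Implicit Defensive.
Import Order.TTheory GRing.Theory Num.Theory.
Local Open Scope ring_scope.

Section Defs.
Variable R : comUnitRingType.

Definition is_order : Prop :=
  exists (n : nat) (b : 'I_n -> R),
    forall x : R, exists! c : {ffun 'I_n -> int}, x = \sum_(i < n) b i *~ c i.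

Definition reduced : Prop := forall (x : R) (n : nat), x ^+ n = 0 -> x = 0.

Definition connected : Prop :=
  (0 : R) <> 1 /\ forall e : R, e * e = e -> e = 0 \/ e = 1.

Definition subring_in (S C : R -> Prop) : Prop :=
  (forall x, C x -> S x) /\ C 1 /\ (forall x y, C x -> C y -> C (x - y)) /\
  (forall x y, C x -> C y -> C (x * y)).

Definition subgroup_units_in (S J : R -> Prop) : Prop :=
  (forall x, J x -> S x /\ exists y, S y /\ x * y = 1) /\ J 1 /\
  (forall x y, J x -> J y -> J (x * y)) /\
  (forall x y, J x -> x * y = 1 -> J y).

(* c : R -> R is a finitely supported function J -> C (zero outside J) and
   x is its image under the natural map C[J] -> R *)
Definition grp_rep (C J : R -> Prop) (x : R) (c : R -> R) : Prop :=
  (forall g, C (c g)) /\ (forall g, ~ J g -> c g = 0) /\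
  exists s : seq R, [/\ uniq s, (forall g, g \notin s -> c g = 0) &
                        x = \sum_(g <- s) c g * g].

(* (C, J) in D(S): C subring of S, J subgroup of S^*, and the natural map
   C[J] -> S is an isomorphism (it is a ring homomorphism automatically, so
   this is bijectivity: every x in S has exactly one preimage). *)
Definition inD_in (S C J : R -> Prop) : Prop :=
  subring_in S C /\ subgroup_units_in S J /\
  (forall x, S x -> exists c, grp_rep C J x c) /\
  (forall x c c', S x -> grp_rep C J x c -> grp_rep C J x c' -> forall g, c g = c' g).

Definition inD (A G : R -> Prop) : Prop := inD_in (fun _ => True) A G.

(* A subring A is stark if it is not (isomorphic to) a group ring C[J] with
   J a non-trivial group, i.e. every (C, J) in D(A) has J trivial. *)
Definition stark (A : R -> Prop) : Prop :=
  forall C J, inD_in A C J -> forall x, J x -> x = 1.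

Definition ring_iso_on (A B : R -> Prop) (phi : R -> R) : Prop :=
  (forall x, A x -> B (phi x)) /\
  (forall x y, A x -> A y -> phi x = phi y -> x = y) /\
  (forall y, B y -> exists x, A x /\ phi x = y) /\
  (forall x y, A x -> A y -> phi (x + y) = phi x + phi y) /\
  (forall x y, A x -> A y -> phi (x * y) = phi x * phi y) /\
  phi 1 = 1.

Definition group_iso_on (G H : R -> Prop) (phi : R -> R) : Prop :=
  (forall x, G x -> H (phi x)) /\
  (forall x y, G x -> G y -> phi x = phi y -> x = y) /\
  (forall y, H y -> exists x, G x /\ phi x = y) /\
  (forall x y, G x -> G y -> phi (x * y) = phi x * phi y).

Definition grad_rep (D : zmodType) (Rd : D -> R -> Prop) (x : R) (c : D -> R)
  : Prop :=
  (forall d, Rd d (c d)) /\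
  exists s : seq D, [/\ uniq s, (forall d, d \notin s -> c d = 0) &
                        x = \sum_(d <- s) c d].

Definition grading (D : zmodType) (Rd : D -> R -> Prop) : Prop :=
  (forall d, Rd d 0) /\
  (forall d x y, Rd d x -> Rd d y -> Rd d (x - y)) /\
  (forall d e x y, Rd d x -> Rd e y -> Rd (d + e) (x * y)) /\
  (forall x, exists c, grad_rep Rd x c) /\
  (forall x c c', grad_rep Rd x c -> grad_rep Rd x c' -> forall d, c d = c' d).

Definition pushforward (G E : zmodType) (Rg : G -> R -> Prop) (f : G -> E)
  (eps : E) (x : R) : Prop :=
  exists (s : seq G) (c : G -> R),
    [/\ uniq s, (forall g, g \in s -> Rg g (c g) /\ f g = eps) &
        x = \sum_(g <- s) c g].

Definition additive_hom (G E : zmodType) (f : G -> E) : Prop :=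
  forall a b, f (a + b) = f a + f b.

Definition universal_grading (G : zmodType) (Rg : G -> R -> Prop) : Prop :=
  grading Rg /\
  forall (E : zmodType) (Se : E -> R -> Prop), grading Se ->
    exists f : G -> E,
      [/\ additive_hom f,
          (forall eps x, Se eps x <-> pushforward Rg f eps x) &
          (forall f' : G -> E, additive_hom f' ->
             (forall eps x, Se eps x <-> pushforward Rg f' eps x) ->
             forall g, f' g = f g)].

Definition root_of_unity (z : R) : Prop := exists n : nat, (0 < n)%N /\ z ^+ n = 1.

Section Grad.
Variables (G : zmodType) (Rg : G -> R -> Prop).

(* d : mu -> Gamma, zeta |-> the (unique) gamma with zeta in R_gamma *)
Definition degmap (z : R) : G := epsilon (inhabits 0) (fun g => Rg g z).

Definition homGmu (f : G -> R) : Prop :=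
  (forall g, root_of_unity (f g)) /\ (forall a b, f (a + b) = f a * f b).

(* Q(d) = Z (+) Hom(Gamma, mu); Hom written additively in the paper,
   multiplicatively here: (m g)(gamma) = g(gamma)^m, (f + g) = pointwise product,
   0 = constant 1. *)
Definition Qd_elt (x : int * (G -> R)) : Prop := homGmu x.2.

Definition Qd_mul (x y : int * (G -> R)) : int * (G -> R) :=
  (x.1 * y.1, fun gam => (y.2 gam) ^ x.1 * (x.2 gam) ^ y.1 * x.2 (degmap (y.2 gam))).

Definition Qd_one : int * (G -> R) := (1, fun _ => 1).

Definition Qd_eq (x y : int * (G -> R)) : Prop :=
  x.1 = y.1 /\ forall gam, x.2 gam = y.2 gam.

(* 1 + f lies in U^*(d) = (1 + Hom(Gamma, mu)) cap Q(d)^* *)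
Definition in_Ustar (f : G -> R) : Prop :=
  homGmu f /\
  exists y, Qd_elt y /\ Qd_eq (Qd_mul (1, f) y) Qd_one /\ Qd_eq (Qd_mul y (1, f)) Qd_one.

(* action of 1 + f on R: x = sum_gam x_gam |-> sum_gam f(gam) x_gam *)
Definition act_rel (f : G -> R) (x y : R) : Prop :=
  exists (s : seq G) (c : G -> R),
    [/\ uniq s, (forall g, Rg g (c g)), (forall g, g \notin s -> c g = 0),
        x = \sum_(g <- s) c g & y = \sum_(g <- s) f g * c g].

Definition act_img (f : G -> R) (A : R -> Prop) (y : R) : Prop :=
  exists x, A x /\ act_rel f x y.

Definition same_orbit (A H A' H' : R -> Prop) : Prop :=
  exists f, in_Ustar f /\ (forall y, act_img f A y <-> A' y) /\
                          (forall y, act_img f H y <-> H' y).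
End Grad.
End Defs.

(* Main.v *)
Require Import Defs.
From HB Require Import structures.
From mathcomp Require Import all_boot all_order all_algebra.
From mathcomp Require Import boolp zify.
From Stdlib Require Import ClassicalEpsilon.
Set Implicit Arguments. Unset Strict Implicit. Unset Printing Implicit Defensive.
Import GRing.Theory.
Local Open Scope ring_scope.

(** If [R = A[G]], the grading of [R] by [G] is induced by a homomorphism
    [p : Gam -> G].  The elements of [G] turn out to be homogeneous, so that
    [p d p = p], i.e. [p] is an idempotent of the ring [Hom(Gam, U)], where [U]
    is the group of homogeneous units and the product is [f * g = f d g];
    moreover [A] is the sum of the [R_g] with [p g = 0] and [G] is the image of
    [p].  Conversely, idempotents give group ring decompositions.
    Let [p] and [q] belong to [(A, G)] and [(B, H)].  If [q d] were not injective
    on the finite group [G], then a Fitting decomposition of [p d q d] on [G]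
    would yield a nonzero idempotent orthogonal to [q], splitting a nontrivial
    group off the stark ring [B].  By symmetry [p d] and [q d] are isomorphisms
    between [G] and [H], so there is an idempotent [r] with the kernel of [p] and
    the image of [q]; it belongs to [(A, H)].  Finally the unit
    [1 + r - p - q + q * p] conjugates [p] to [q]. *)

(** * Idempotents in [Hom(Gam, U)] *)

Lemma zmod_morphism_additive (U V : zmodType) (f : U -> V) :
  zmod_morphism f -> exists g : {additive U -> V}, g =1 f.
Proof.
move=> fB; pose m := GRing.isZmodMorphism.Build U V f fB.
by pose g : {additive U -> V} := HB.pack f m; exists g.
Qed.

Lemma additive_hom_zmod (U V : zmodType) (f : U -> V) :
  additive_hom f -> exists g : {additive U -> V}, g =1 f.
Proof.
by move=> fD; apply: zmod_morphism_additive => x y; rewrite -{2}(subrK y x)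
  [in RHS]fD addrK.
Qed.

(** Pigeonhole on the restrictions of the iterates to the finite set [s]: two of them agree, so the
    iterates are eventually periodic. *)
Lemma iter_idempotent (T : choiceType) (f : T -> T) (s : seq T) :
  {in s, forall x, f x \in s} ->
  exists2 N, (0 < N)%N & {in s, forall x, iter (N + N) f x = iter N f x}.
Proof.
move=> fs.
have iters k : {in s, forall x, iter k f x \in s}.
  by move=> x xs; elim: k => //= k; apply: fs.
pose g k : {ffun seq_sub s -> seq_sub s} :=
  [ffun x => SeqSub (iters k _ (ssvalP x))].
pose h (i : 'I_(#|{ffun seq_sub s -> seq_sub s}|).+1) := g i.
have /injectivePn [i [j ij /ffunP hij]] : ~~ injectiveb h.
  by apply/negP => /injectiveP /leq_card; rewrite card_ord ltnn.
have gij : {in s, forall x, iter i f x = iter j f x}.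
  by move=> x xs; have := hij (SeqSub xs); rewrite !ffunE => /(congr1 val).
wlog ltij : i j ij gij {hij} / (i < j)%N.
  move=> W; case: (ltngtP i j) => [|ji|/val_inj e]; first exact: W.
  - apply: (W j i) => //; first by rewrite eq_sym.
    by move=> x xs; rewrite gij.
  - by rewrite e eqxx in ij.
pose c := (j - i)%N.
have c0 : (0 < c)%N by rewrite subn_gt0.
have per m : (i <= m)%N -> {in s, forall x, iter (m + c) f x = iter m f x}.
  move=> im x xs; rewrite -(subnK im) -addnA subnKC ?(ltnW ltij) // !iterD.
  by rewrite gij.
have perk k m : (i <= m)%N -> {in s, forall x, iter (m + k * c) f x = iter m f x}.
  move=> im x xs; elim: k => [|k IH]; first by rewrite addn0.
  by rewrite mulSnr addnA per // (leq_trans im) // leq_addr.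
(* A positive multiple of the period [c] that is at least [i], hence already in the periodic
   range. *)
exists (i.+1 * c)%N; first by rewrite muln_gt0.
by move=> x xs; apply: perk => //; rewrite (leq_trans (leqnSn i)) ?leq_pmulr.
Qed.

(** Some iterate of the translation by [u] is idempotent at [0], which reads
    [u *+ (N + N) = u *+ N]. *)
Lemma finite_torsion (U : zmodType) (s : seq U) (u : U) :
  0 \in s -> {in s, forall x, u + x \in s} -> exists2 n, (0 < n)%N & u *+ n = 0.
Proof.
move=> s0 /iter_idempotent [N N0 /(_ 0 s0)]; rewrite !iter_addr !addr0 mulrnDr.
by move/eqP; rewrite addrC -subr_eq0 addrK => /eqP; exists N.
Qed.

(* In the ring [Hom(Gam, U)] with product [f d g], [p] and [q] are idempotents
   and [T] is [p q] acting on [im p]. *)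
Section Idempotents.
Variables (Gam U : zmodType) (d : {additive U -> Gam}) (p q : {additive Gam -> U}).
Hypotheses (pp : forall a, p (d (p a)) = p a) (qq : forall a, q (d (q a)) = q a).

Let T : {additive U -> U} := p \o d \o q \o d.

Let iterB n : zmod_morphism (iter n T).
Proof.
by elim: n => [|n IH] x y //; rewrite !iterS IH raddfB.
Qed.

Let pdT x : p (d (T x)) = T x. Proof. exact: pp. Qed.

Let iter_im n x : p (d x) = x -> p (d (iter n T x)) = iter n T x.
Proof. by case: n => // n _; rewrite iterS pdT. Qed.

(* Fitting: on the part of [im p] where [p q p] is nilpotent, [p (1 - q) p] is
   invertible with inverse [w], and then [(1 - q) w (1 - q)] is an idempotent
   orthogonal to [q]. *)
Lemma orthogonal_idempotent N :
  (0 < N)%N -> (forall x, p (d x) = x -> iter (N + N) T x = iter N T x) ->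
  exists e : {additive Gam -> U},
    [/\ forall a, e (d (e a)) = e a, forall a, q (d (e a)) = 0,
        forall a, e (d (q a)) = 0 &
        forall x, p (d x) = x -> q (d x) = 0 -> e (d x) = x].
Proof.
move=> N0 hN.
(* The geometric series [1 + T + ... + T^(N-1)] times [1 - T^N]. On [im p] the latter projects onto
   the part killed by [T^N], where the series inverts [1 - T]. *)
pose w0 x := \sum_(k < N) (iter k T x - iter (N + k) T x).
have [w wE] : exists w : {additive U -> U}, w =1 w0.
  apply: zmod_morphism_additive => x y; rewrite /w0 -sumrB.
  by apply: eq_bigr => k _; rewrite !iterB opprB addrACA [- _ + _]addrC
    !opprB addrACA.
have w_im x : p (d x) = x -> p (d (w x)) = w x.
  move=> px; rewrite !wE /w0 !raddf_sum; apply: eq_bigr => k _.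
  by rewrite !raddfB !iter_im.
have wT x : p (d x) = x -> w x - T (w x) = x - iter N T x.
  move=> px; rewrite !wE /w0 raddf_sum -sumrB.
  pose F k := iter (N + k) T x - iter k T x.
  rewrite (eq_bigr (fun k : 'I_N => F k.+1 - F k)); last first.
    by move=> k _; rewrite /F addnS !iterS raddfB !opprB addrC.
  rewrite -(big_mkord xpredT (fun k => F k.+1 - F k)) telescope_sumr //.
  by rewrite /F hN // addn0 /= subrr sub0r opprB.
have wN x : p (d x) = x -> w (x - iter N T x) = w x.
  move=> px; rewrite !wE /w0; apply: eq_bigr => k _.
  rewrite !iterB -!iterD addnAC [(N + N + k)%N]addnC [iter (k + (N + N)) _ _]iterD.
  by rewrite hN // -iterD [(N + k)%N]addnC ?subrr subr0.
(* This is [(1 - q) w p (1 - q)], multiplied out so that every term is a homomorphism from [Gam] to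
   [U]. *)
pose e := (w \o (p \- (p \o d \o q))) \- (q \o d \o (w \o (p \- (p \o d \o q)))).
exists e; split.
- move=> a; rewrite /e /=; set y := w (p a - _).
  have py : p (d y) = y by apply: w_im; rewrite !raddfB /= !pp.
  have -> : p (d (y - q (d y))) - p (d (q (d (y - q (d y))))) = y - T y.
    by rewrite !raddfB /= py qq subrr addr0.
  have -> // : w (y - T y) = y.
  by rewrite wT ?wN // !raddfB /= !pp.
- by move=> a; rewrite /e /=; set y := w _; rewrite !raddfB /= qq subrr.
- by move=> a; rewrite /e /= qq subrr !raddf0 addr0.
- move=> x px qx; rewrite /e /= px qx !raddf0 addr0.
  (* Here [q (d x) = 0] forces [T x = 0], so of [w0 x] only the term [iter 0 T x = x] survives;
     [0 < N] matters for this. *)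
  have it0 k : iter k.+1 T x = 0.
    by elim: k => [|k IH]; [rewrite /= /T /= qx !raddf0 | rewrite iterS IH raddf0].
  have -> : w x = x.
    rewrite wE /w0; case: N N0 {hN w0 wE wT wN w_im} => // n _.
    rewrite big_ord_recl big1 => [|k _]; first by rewrite addn0 it0 subr0 addr0.
    by rewrite addSn lift0 !it0 subrr.
  by rewrite qx subr0.
Qed.

(** The two injectivity hypotheses make [T] injective on [im p], so [T^(2N) = T^N] there improves to
    [T^N = 1]. Then [r = q T^(N-1) p] satisfies [p r = T^N p = p]. *)
Lemma connecting_idempotent N :
  (0 < N)%N -> (forall x, p (d x) = x -> iter (N + N) T x = iter N T x) ->
  (forall x, p (d x) = x -> q (d x) = 0 -> x = 0) ->
  (forall x, q (d x) = x -> p (d x) = 0 -> x = 0) ->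
  exists r : {additive Gam -> U},
    [/\ forall a, p (d (r a)) = p a, forall a, q (d (r a)) = r a,
        forall a, r (d (q a)) = q a, forall a, r (d (p a)) = r a &
        forall a, r (d (r a)) = r a].
Proof.
case: N => // n _ hN injq injp.
have iter_inj k x y : p (d x) = x -> p (d y) = y -> iter k T x = iter k T y -> x = y.
  move=> px py; elim: k => //= k IH e; apply: IH; apply/eqP; rewrite -subr_eq0.
  apply/eqP/injq; first by rewrite !raddfB /= !iter_im.
  apply: injp; first by rewrite qq.
  by rewrite !raddfB /=; move/eqP: e; rewrite -subr_eq0 => /eqP.
have TN x : p (d x) = x -> iter n.+1 T x = x.
  move=> px; apply: (@iter_inj n.+1) => //; first exact: iter_im.
  by rewrite -iterD hN.
have [t tE] := zmod_morphism_additive (iterB n).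
pose r := q \o d \o t \o p; exists r.
have pr a : p (d (r a)) = p a.
  by rewrite /r /= tE -[RHS]TN ?pp.
have qr a : q (d (r a)) = r a by rewrite /r /= qq.
(* [p d] is injective on [im q], so [r q = q] and [r r = r] may be checked after applying [p d],
   where [p r = p] settles them. *)
have uniq_im x y : q (d x) = x -> q (d y) = y -> p (d x) = p (d y) -> x = y.
  move=> qx qy /eqP; rewrite -subr_eq0 => /eqP e.
  apply/eqP; rewrite -subr_eq0; apply/eqP/injp; first by rewrite !raddfB /= qx qy.
  by rewrite !raddfB.
split=> // a.
- by apply: uniq_im => //; rewrite pr.
- by rewrite /r /= pp.
- by apply: uniq_im => //; rewrite pr.
Qed.
End Idempotents.

(** * Components of a grading *)

Lemma sum_support (I : eqType) (V : nmodType) (s t : seq I) (F : I -> V) :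
  uniq s -> uniq t -> {subset s <= t} -> (forall i, i \notin s -> F i = 0) ->
  \sum_(i <- t) F i = \sum_(i <- s) F i.
Proof.
move=> us ut st F0; rewrite (bigID (mem s)) /= [X in _ + X]big1 ?addr0.
  rewrite -big_filter; apply: perm_big; apply: uniq_perm => //.
    exact: filter_uniq.
  by move=> i; rewrite mem_filter; case: (boolP (i \in s)) => // /st ->.
by move=> i /F0.
Qed.

Section Grading.
Variables (R : comUnitRingType) (D : zmodType) (Rd : D -> R -> Prop).

(** Explicit additive projections give uniqueness of decompositions: applying [pr d] to any
    decomposition recovers its component at [d]. *)
Lemma grading_of_projections (pr : D -> R -> R) :
  (forall d x y, Rd d x -> Rd d y -> Rd d (x - y)) ->
  (forall d e x y, Rd d x -> Rd e y -> Rd (d + e) (x * y)) ->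
  (forall d x, Rd d (pr d x)) ->
  (forall x, exists s, [/\ uniq s, forall d, d \notin s -> pr d x = 0 &
                           x = \sum_(d <- s) pr d x]) ->
  (forall d x y, pr d (x + y) = pr d x + pr d y) ->
  (forall d e x, Rd e x -> pr d x = if d == e then x else 0) ->
  grading Rd.
Proof.
move=> RB RM Rpr sumpr prD prE.
have R0 d : Rd d 0 by rewrite -(subrr (pr d 0)); apply: RB; apply: Rpr.
have pr_rep x c : grad_rep Rd x c -> forall d, c d = pr d x.
  move=> [Rc [s [us c0 ->]]] d.
  have -> : pr d (\sum_(e <- s) c e) = \sum_(e <- s) pr d (c e).
    by apply: big_morph => //; rewrite (prE d d) ?eqxx.
  case: (boolP (d \in s)) => ds.
    rewrite (bigD1_seq d) //= (prE _ d) // eqxx big1 ?addr0 // => e /negPf ed.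
    by rewrite (prE _ e) // eq_sym ed.
  rewrite c0 // big1_seq // => e /andP [_ es]; rewrite (prE _ e) //.
  by case: eqP es ds => // -> ->.
split=> //; split=> //; split=> //; split.
  by move=> x; exists (pr^~ x); split.
by move=> x c c' hc hc' d; rewrite (pr_rep _ _ hc) (pr_rep _ _ hc').
Qed.

Hypothesis gr : grading Rd.

Let R0 d : Rd d 0. Proof. by case: gr. Qed.
Let RB d x y : Rd d x -> Rd d y -> Rd d (x - y).
Proof. by case: gr => _ [h _]; apply: h. Qed.
Let RM d e x y : Rd d x -> Rd e y -> Rd (d + e) (x * y).
Proof. by case: gr => _ [_ [h _]]; apply: h. Qed.

Definition cmp (x : R) : D -> R := epsilon (inhabits (fun=> 0)) (grad_rep Rd x).

Lemma cmpP x : grad_rep Rd x (cmp x).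
Proof. by apply: epsilon_spec; case: gr => _ [_ [_ [h _]]]. Qed.

Lemma cmp_unique x c : grad_rep Rd x c -> cmp x = c.
Proof.
by case: gr => _ [_ [_ [_ h]]] hc; apply/funext; apply: h (cmpP x) hc.
Qed.

Lemma cmp_in x d : Rd d (cmp x d). Proof. by case: (cmpP x). Qed.

Lemma cmp_support x : exists s, [/\ uniq s, forall d, d \notin s -> cmp x d = 0 &
  x = \sum_(d <- s) cmp x d].
Proof. by case: (cmpP x). Qed.

Lemma cmpB x y d : cmp (x - y) d = cmp x d - cmp y d.
Proof.
rewrite (@cmp_unique _ (fun d => cmp x d - cmp y d)) //; split.
  by move=> e; apply: RB; apply: cmp_in.
have [s [us s0 {2}->]] := cmp_support x; have [t [ut t0 {2}->]] := cmp_support y.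
exists (undup (s ++ t)); split; first exact: undup_uniq.
  move=> e; rewrite mem_undup mem_cat negb_or => /andP [es et].
  by rewrite s0 // t0 // subr0.
by rewrite sumrB; congr (_ - _); apply/esym/sum_support => //;
  rewrite ?undup_uniq // => e; rewrite mem_undup mem_cat => ->; rewrite ?orbT.
Qed.

Lemma cmp0 d : cmp 0 d = 0.
Proof. by have := cmpB 0 0 d; rewrite !subrr. Qed.

Lemma cmpD x y d : cmp (x + y) d = cmp x d + cmp y d.
Proof. by rewrite -{1}[y]opprK -[- y]sub0r !cmpB cmp0 sub0r opprK. Qed.

Lemma cmp_sum I (s : seq I) (F : I -> R) d :
  cmp (\sum_(i <- s) F i) d = \sum_(i <- s) cmp (F i) d.
Proof. by apply: (big_morph (cmp^~ d)); [move=> x y; apply: cmpD | apply: cmp0]. Qed.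

Lemma cmp_homog e x d : Rd e x -> cmp x d = if d == e then x else 0.
Proof.
move=> Rx; rewrite (@cmp_unique _ (fun d => if d == e then x else 0)) //; split.
  by move=> d'; case: eqP => [->|_].
exists [:: e]; split=> // [d'|]; last by rewrite big_seq1 eqxx.
by rewrite inE => /negPf ->.
Qed.

Lemma homog_deg d e x : Rd d x -> Rd e x -> x <> 0 -> d = e.
Proof.
move=> Rdx Rex x0; have := cmp_homog d Rex; rewrite (cmp_homog d Rdx) eqxx.
by case: eqP.
Qed.

Lemma cmpM d e x y : Rd d x -> cmp (x * y) e = x * cmp y (e - d).
Proof.
move=> Rx; rewrite (@cmp_unique _ (fun e => x * cmp y (e - d))) //; split.
  by move=> a; rewrite -{1}(subrK d a) addrC; apply: RM => //; apply: cmp_in.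
have [s [us s0 {2}->]] := cmp_support y.
exists (map (+%R^~ d) s); split.
- by rewrite map_inj_uniq //; apply: addIr.
- move=> a ha; rewrite s0 ?mulr0 //; apply: contra ha => ha.
  by apply/mapP; exists (a - d) => //; rewrite subrK.
- by rewrite big_map mulr_sumr; apply: eq_bigr => a _; rewrite addrK.
Qed.

Lemma additive_ext (V : zmodType) (phi psi : R -> V) :
  {morph phi : x y / x + y} -> {morph psi : x y / x + y} ->
  (forall d x, Rd d x -> phi x = psi x) -> phi =1 psi.
Proof.
move=> phiD psiD hom x; have [s [_ _ ->]] := cmp_support x.
have z (f : R -> V) : {morph f : x y / x + y} -> f 0 = 0.
  by move=> fD; apply: (addrI (f 0)); rewrite -fD !addr0.
rewrite (big_morph phi phiD (z _ phiD)) (big_morph psi psiD (z _ psiD)).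
by apply: eq_bigr => d _; apply: hom (cmp_in _ _).
Qed.

(** Comparing components in [x = x * 1] for homogeneous [x] shows that multiplication by the degree
    0 component of [1] is the identity; evaluate it at [1]. *)
Lemma grading1 : Rd 0 1.
Proof.
suff -> : 1 = cmp 1 0 by apply: cmp_in.
rewrite -[RHS]mul1r; apply: (additive_ext (phi := id) (psi := *%R^~ (cmp 1 0))) => //.
  by move=> x y; rewrite mulrDl.
move=> d x Rx; have := cmpM d 1 Rx.
by rewrite mulr1 (cmp_homog _ Rx) eqxx subrr.
Qed.

(** The direct sum of the [Rd d] over [d] in [K], encoded by vanishing components so that no finite
    family has to be carried along. *)
Definition Rsum (K : D -> Prop) (x : R) := forall d, ~ K d -> cmp x d = 0.

Lemma Rsum_homog (K : D -> Prop) d x : K d -> Rd d x -> Rsum K x.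
Proof.
move=> Kd Rx e Ke; rewrite (cmp_homog _ Rx).
by case: eqP => // ed; case: Ke; rewrite ed.
Qed.

Lemma Rsum0 (K : D -> Prop) : Rsum K 0.
Proof. by move=> d _; rewrite cmp0. Qed.

Lemma RsumB (K : D -> Prop) x y : Rsum K x -> Rsum K y -> Rsum K (x - y).
Proof. by move=> hx hy d Kd; rewrite cmpB hx // hy // subr0. Qed.

Lemma RsumD (K : D -> Prop) x y : Rsum K x -> Rsum K y -> Rsum K (x + y).
Proof. by move=> hx hy d Kd; rewrite cmpD hx // hy // addr0. Qed.

Lemma Rsum_sum (K : D -> Prop) I (s : seq I) (P : pred I) (F : I -> R) :
  (forall i, P i -> Rsum K (F i)) -> Rsum K (\sum_(i <- s | P i) F i).
Proof. by move=> h; apply: big_ind => //; [apply: Rsum0 | apply: RsumD]. Qed.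

Lemma Rsum_ind (K : D -> Prop) (P : R -> Prop) :
  P 0 -> (forall x y, P x -> P y -> P (x + y)) ->
  (forall d x, K d -> Rd d x -> P x) -> forall x, Rsum K x -> P x.
Proof.
move=> P0 PD Ph x hx; have [s [_ _ ->]] := cmp_support x.
apply: big_ind => // d _; case: (EM (K d)) => Kd; first exact: Ph (cmp_in x d).
by rewrite hx.
Qed.

Lemma RsumM (K L M : D -> Prop) x y :
  (forall d e, K d -> L e -> M (d + e)) ->
  Rsum K x -> Rsum L y -> Rsum M (x * y).
Proof.
move=> KLM hx; move: x hx y; apply: Rsum_ind.
- by move=> y _; rewrite mul0r; apply: Rsum0.
- by move=> x x' h h' y hy; rewrite mulrDl; apply: RsumD; [apply: h | apply: h'].
move=> d x Kd Rx; apply: Rsum_ind.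
- by rewrite mulr0; apply: Rsum0.
- by move=> y y' h h'; rewrite mulrDr; apply: RsumD.
by move=> e y Le Ry; apply: (Rsum_homog (d := d + e)); [apply: KLM | apply: RM].
Qed.

Lemma Rsum_homog_inv (K : D -> Prop) d x : Rd d x -> x <> 0 -> Rsum K x -> K d.
Proof.
move=> Rx x0 hx; apply: contrapT => Kd.
by have := hx d Kd; rewrite (cmp_homog _ Rx) eqxx.
Qed.

Lemma cmp_inj x y : cmp x =1 cmp y -> x = y.
Proof.
move=> xy; apply/eqP; rewrite -subr_eq0; apply/eqP.
have [s [_ _ ->]] := cmp_support (x - y).
by apply: big1 => d _; rewrite cmpB xy subrr.
Qed.

Lemma Rsum_cmp (K : D -> Prop) x d : Rsum K x -> Rsum K (cmp x d).
Proof.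
move=> hx; case: (EM (K d)) => Kd; first exact: Rsum_homog (cmp_in x d).
by rewrite hx //; apply: Rsum0.
Qed.
Lemma pushforwardE (E : zmodType) (f : D -> E) e x :
  pushforward Rd f e x <-> Rsum (fun d => f d = e) x.
Proof.
split=> [[s [c [us hs ->]]]|hx].
  rewrite big_seq; apply: Rsum_sum => d /hs [Rc fd].
  exact: (Rsum_homog (d := d)).
have [s [us s0 xE]] := cmp_support x.
exists [seq d <- s | f d == e], (cmp x); split.
- exact: filter_uniq.
- by move=> d; rewrite mem_filter => /andP [/eqP fd _]; split=> //; apply: cmp_in.
- rewrite big_filter big_rmcond //= => d /eqP fd; exact: hx.
Qed.
End Grading.

(** * Groups of units and gradings of group rings *)

Notation units_subgroup := (subgroup_units_in (fun _ => True)).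

(* A group of units [J], written additively; [sval] turns sums into products. *)
Definition ugrp (R : comUnitRingType) (J : R -> Prop) of units_subgroup J :=
  {x : R | `[< J x >]}.

Section UnitGroup.
Variables (R : comUnitRingType) (J : R -> Prop) (hJ : units_subgroup J).

HB.instance Definition _ := SubChoice.copy (ugrp hJ) {x : R | `[< J x >]}.

Definition uval (u : ugrp hJ) : R := sval u.

Lemma uval_inj : injective uval. Proof. exact: val_inj. Qed.

Lemma uvalP u : J (uval u). Proof. exact: asboolW (svalP u). Qed.

Definition umk x (hx : J x) : ugrp hJ := exist _ x (asboolT hx).

Lemma umkK x (hx : J x) : uval (umk hx) = x. Proof. by []. Qed.

Lemma ugrp_unit x : J x -> x \is a GRing.unit.
Proof. by case: hJ => h _ /h [_ [y [_ xy]]]; apply/unitrPr; exists y. Qed.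

Let u1 : J 1. Proof. by case: hJ => _ []. Qed.

Let uM x y : J x -> J y -> J (x * y).
Proof. by case: hJ => _ [_ [h _]]; apply: h. Qed.

Let uV x : J x -> J x^-1.
Proof.
move=> hx; case: (hJ) => _ [_ [_ h]]; apply: (h _ _ hx).
by apply: divrr; apply: ugrp_unit.
Qed.

Let uadd (u v : ugrp hJ) := umk (uM (uvalP u) (uvalP v)).
Let uopp (u : ugrp hJ) := umk (uV (uvalP u)).

Let uaddA : associative uadd.
Proof. by move=> u v w; apply: uval_inj; exact: mulrA. Qed.
Let uaddC : commutative uadd.
Proof. by move=> u v; apply: uval_inj; exact: mulrC. Qed.
Let uadd0 : left_id (umk u1) uadd.
Proof. by move=> u; apply: uval_inj; exact: mul1r. Qed.
Let uaddN : left_inverse (umk u1) uopp uadd.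
Proof. by move=> u; apply: uval_inj; apply: mulVr; apply: ugrp_unit (uvalP u). Qed.

HB.instance Definition _ := GRing.isZmodule.Build (ugrp hJ) uaddA uaddC uadd0 uaddN.

Lemma uval0 : uval 0 = 1. Proof. by []. Qed.
Lemma uvalD u v : uval (u + v) = uval u * uval v. Proof. by []. Qed.
Lemma uvalN u : uval (- u) = (uval u)^-1. Proof. by []. Qed.
Lemma uval_unit u : uval u \is a GRing.unit. Proof. exact: ugrp_unit (uvalP u). Qed.
Lemma uvalMn u n : uval (u *+ n) = uval u ^+ n.
Proof. by elim: n => // n IH; rewrite mulrS exprS uvalD IH. Qed.
End UnitGroup.

(** * Coefficients in a group ring and its grading by the group *)

Section GroupRing.
Variables (R : comUnitRingType) (A G : R -> Prop) (hAG : inD A G).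

Lemma inD_group : units_subgroup G. Proof. by case: hAG => _ []. Qed.
Local Notation gG := (ugrp inD_group).

Let A1 : A 1. Proof. by case: hAG => -[_ []]. Qed.
Let AB x y : A x -> A y -> A (x - y).
Proof. by case: hAG => -[_ [_ [h _]]] _; apply: h. Qed.
Let AM x y : A x -> A y -> A (x * y).
Proof. by case: hAG => -[_ [_ [_ h]]] _; apply: h. Qed.
Let A0 : A 0. Proof. by rewrite -(subrr 1); apply: AB. Qed.
Let AD x y : A x -> A y -> A (x + y).
Proof. by move=> hx hy; rewrite -[y]opprK -[- y]sub0r; apply: AB => //; apply: AB. Qed.

Definition gcoef (x : R) : R -> R := epsilon (inhabits (fun=> 0)) (grp_rep A G x).

Lemma gcoefP x : grp_rep A G x (gcoef x).
Proof. by apply: epsilon_spec; case: hAG => _ [_ [h _]]; apply: h. Qed.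

Lemma gcoef_unique x c : grp_rep A G x c -> gcoef x = c.
Proof.
by case: hAG => _ [_ [_ h]] hc; apply/funext; apply: h I (gcoefP x) hc.
Qed.

Lemma gcoef_in x g : A (gcoef x g). Proof. by case: (gcoefP x). Qed.

Lemma gcoefD x y g : gcoef (x + y) g = gcoef x g + gcoef y g.
Proof.
rewrite (@gcoef_unique _ (fun g => gcoef x g + gcoef y g)) //.
have [_ [xG [s [us s0 xE]]]] := gcoefP x; have [_ [yG [t [ut t0 yE]]]] := gcoefP y.
split; first by move=> e; apply: AD; apply: gcoef_in.
split; first by move=> e he; rewrite xG // yG // addr0.
exists (undup (s ++ t)); split; first exact: undup_uniq.
  move=> e; rewrite mem_undup mem_cat negb_or => /andP [es et].
  by rewrite s0 // t0 // addr0.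
rewrite {1}xE {1}yE; under [RHS]eq_bigr do rewrite mulrDl.
rewrite big_split; congr (_ + _); apply/esym/sum_support => //;
  rewrite ?undup_uniq //; first last.
- by move=> e he; rewrite t0 // mul0r.
- by move=> e; rewrite mem_undup mem_cat => ->; rewrite ?orbT.
- by move=> e he; rewrite s0 // mul0r.
- by move=> e; rewrite mem_undup mem_cat => ->.
Qed.

Lemma gcoefE a g h : A a -> G g -> gcoef (a * g) h = if h == g then a else 0.
Proof.
move=> Aa Gg; rewrite (@gcoef_unique _ (fun h => if h == g then a else 0)) //.
split; first by move=> k; case: eqP.
split; first by move=> k Gk; case: eqP => // kg; case: Gk; rewrite kg.
exists [:: g]; split=> // [k|]; last by rewrite big_seq1 eqxx.
by rewrite inE => /negPf ->.
Qed.

Lemma gcoef_sum x : exists s : seq gG, [/\ uniq s,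
  forall u, u \notin s -> gcoef x (uval u) = 0 &
  x = \sum_(u <- s) gcoef x (uval u) * uval u].
Proof.
have [_ [xG [s [us s0 xE]]]] := gcoefP x.
exists (pmap insub s); split.
- exact: pmap_sub_uniq.
- by move=> u; rewrite mem_pmap_sub; apply: s0.
have -> : \sum_(u <- pmap insub s : seq gG) gcoef x (uval u) * uval u
    = \sum_(g <- map (@uval _ _ inD_group) (pmap insub s)) gcoef x g * g.
  by rewrite big_map.
rewrite (pmap_filter (@insubK _ _ _)) big_filter {1}xE [RHS]big_rmcond //= => g.
by case: insubP => //= /asboolP Gg _; rewrite xG // mul0r.
Qed.

Definition grp_comp (u : gG) (x : R) : Prop := exists2 a, A a & x = a * uval u.

Lemma grp_comp_grading : grading grp_comp.
Proof.
apply: (grading_of_projections (pr := fun u x => gcoef x (uval u) * uval u)).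
- by move=> u _ _ [a Aa ->] [b Ab ->]; exists (a - b); rewrite ?mulrBl //; apply: AB.
- by move=> u v _ _ [a Aa ->] [b Ab ->]; exists (a * b);
    rewrite ?uvalD 1?mulrACA //; apply: AM.
- by move=> u x; exists (gcoef x (uval u)) => //; apply: gcoef_in.
- move=> x; have [s [us s0 xE]] := gcoef_sum x; exists s; split=> // u /s0 ->.
  by rewrite mul0r.
- by move=> u x y; rewrite gcoefD mulrDl.
- move=> u v _ [a Aa ->]; rewrite gcoefE ?(inj_eq (@uval_inj _ _ _)) //;
    last exact: uvalP.
  by case: eqP => [->|_] //; rewrite mul0r.
Qed.

Section Twist.
Variables (Gam : zmodType) (Rg : Gam -> R -> Prop) (gr : grading Rg).
Hypothesis cmpA : forall a g, A a -> A (cmp Rg a g).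

(** Only the degree of the coefficient [a] enters the first coordinate; the degree of the group
    element in [Gam] is deliberately disregarded. *)
Definition twist_comp (e : (Gam * gG)%type) (x : R) : Prop :=
  exists2 a, A a /\ Rg e.1 a & x = a * uval e.2.

Lemma twist_comp_grading : grading twist_comp.
Proof.
case: (gr) => _ [RB [RM _]].
apply: (grading_of_projections
  (pr := fun e x => cmp Rg (gcoef x (uval e.2)) e.1 * uval e.2)).
- move=> e _ _ [a [Aa Ra] ->] [b [Ab Rb] ->].
  by exists (a - b); rewrite ?mulrBl //; split; [apply: AB | apply: RB].
- move=> e f _ _ [a [Aa Ra] ->] [b [Ab Rb] ->].
  by exists (a * b); rewrite ?uvalD 1?mulrACA //; split; [apply: AM | apply: RM].
- move=> e x; exists (cmp Rg (gcoef x (uval e.2)) e.1) => //; split.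
    by apply: cmpA; apply: gcoef_in.
  exact: cmp_in.
- move=> x; have [s [us s0 xE]] := gcoef_sum x.
  (* A finite set [t] of degrees that serves all coefficients of [x] at once; the support then lies
     in the product of [t] and [s]. *)
  have [t [ut tsub]] : exists t : seq Gam, uniq t /\
      forall u, u \in s -> forall g, g \notin t -> cmp Rg (gcoef x (uval u)) g = 0.
    elim: s {us s0 xE} => [|u s [t [ut ht]]]; first by exists [::].
    have [t' [_ ht' _]] := cmp_support gr (gcoef x (uval u)).
    exists (undup (t' ++ t)); split; first exact: undup_uniq.
    move=> v; rewrite inE => /orP [/eqP -> |vs] g;
      rewrite mem_undup mem_cat negb_or => /andP [gt' gt]; first exact: ht'.
    exact: ht.
  exists [seq (g, u) | g <- t, u <- s]; split.
  + by apply: allpairs_uniq => // -[g u] [g' u'] _ _ /= [-> ->].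
  + move=> [g u] /= hgu; case: (boolP (u \in s)) => us'.
      rewrite (tsub u) ?mul0r //; apply: contra hgu => gt.
      by apply/allpairsP; exists (g, u).
    by rewrite s0 // cmp0 // mul0r.
  + rewrite big_allpairs exchange_big {1}xE; apply: eq_big_seq => u us' /=.
    rewrite -mulr_suml; congr (_ * _).
    have [t' [ut' ht' {1}->]] := cmp_support gr (gcoef x (uval u)).
    have st : {subset [seq g <- t' | g \in t] <= t}.
      by move=> g; rewrite mem_filter => /andP [].
    rewrite (sum_support _ ut st) ?filter_uniq //.
      rewrite big_filter [RHS]big_rmcond //= => g gt; exact: tsub.
    move=> g; rewrite mem_filter negb_and => /orP [gt|gt']; first exact: tsub.
    exact: ht'.
- by move=> e x y; rewrite gcoefD cmpD // mulrDl.
- move=> [g u] [h v] _ [a /= [Aa Ra] ->].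
  rewrite gcoefE ?(inj_eq (@uval_inj _ _ _)) //; last exact: uvalP.
  rewrite xpair_eqE andbC; case: eqP => [->|_] /=; last by rewrite cmp0 // mul0r.
  by rewrite (cmp_homog gr _ Ra); case: eqP => //; rewrite mul0r.
Qed.
End Twist.
End GroupRing.

(** * Group ring decompositions as idempotents *)

Section Universal.
Variables (R : comUnitRingType) (Gam : zmodType) (Rg : Gam -> R -> Prop).
Hypotheses (univ : universal_grading Rg) (conn : connected R).

Let gr : grading Rg. Proof. by case: univ. Qed.
Let RM d e x y : Rg d x -> Rg e y -> Rg (d + e) (x * y).
Proof. by case: gr => _ [_ [h _]]; apply: h. Qed.

Let unit_neq0 (x : R) : x \is a GRing.unit -> x <> 0.
Proof. by move=> ux x0; case: conn => + _; apply; rewrite -(mulVr ux) x0 mulr0. Qed.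

Lemma universal_hom (E : zmodType) (Se : E -> R -> Prop) : grading Se ->
  exists f : {additive Gam -> E}, forall e x, Se e x <-> Rsum Rg (fun g => f g = e) x.
Proof.
move=> grS; case: univ => _ /(_ _ _ grS) [f [/additive_hom_zmod [g gf] fS _]].
exists g => e x; rewrite fS.
have -> : (g : Gam -> E) = f by apply/funext.
exact: pushforwardE.
Qed.

Lemma inD_grading_hom A G (h : inD A G) :
  exists f : {additive Gam -> ugrp (inD_group h)},
    (forall u x, grp_comp u x <-> Rsum Rg (fun g => f g = u) x) /\
    (forall x, A x <-> Rsum Rg (fun g => f g = 0) x).
Proof.
have [f fS] := universal_hom (grp_comp_grading h); exists f; split=> // x.
rewrite -fS; split=> [Ax|[a Aa ->]]; first by exists x; rewrite // uval0 mulr1.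
by rewrite uval0 mulr1.
Qed.

(* For the grading [R_g u] ([g] of degree in the kernel of [Gam -> G], [u] in
   [G]), universality makes [R_0 u] a graded [R_0]-submodule of [R]; being
   isomorphic to [R_0], which is connected, it has a single nonzero component. *)
Lemma inD_homogeneous A G x : inD A G -> G x -> exists d, Rg d x.
Proof.
move=> h Gx; have [f [_ fA]] := inD_grading_hom h.
have cmpA a g : A a -> A (cmp Rg a g) by rewrite !fA; apply: Rsum_cmp.
have [t tS] := universal_hom (twist_comp_grading h gr cmpA).
pose u := umk (inD_group h) Gx.
have ux := ugrp_unit (inD_group h) Gx.
have xt : twist_comp Rg (0, u) x.
  exists 1; last by rewrite mul1r.
  by split; [case: (h) => -[_ []] | apply: grading1].
(* By universality the twisted component of degree [(0, u)] is a graded subgroup, so [cmp Rg x d] is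
   [a * x] with [a] in [A] of degree 0. Taking the component at [d] again yields [a * a = a], and
   connectedness applies. *)
have idem d : cmp Rg x d = 0 \/ cmp Rg x d = x.
  have /tS [a [Aa Ra] /= xd] : Rsum Rg (fun g => t g = (0, u)) (cmp Rg x d).
    by apply: Rsum_cmp => //; apply/tS.
  have aa : a * a = a.
    apply: (mulIr ux); rewrite -mulrA -[RHS]xd.
    have := cmp_homog gr d (cmp_in gr x d).
    by rewrite eqxx {1}xd (cmpM gr _ _ Ra) subr0 xd.
  case: conn => _ /(_ a aa) [a0|a1]; [left|right].
    by rewrite xd a0 mul0r.
  by rewrite xd a1 mul1r.
apply: contrapT => nox; apply: (unit_neq0 ux); apply: (cmp_inj gr) => d.
rewrite cmp0 //; case: (idem d) => // xd; case: nox; exists d.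
by rewrite -xd; apply: cmp_in.
Qed.

(** These units form one ambient group containing [G] for every [(A, G)] in [inD]. They need not be
    roots of unity; torsion comes later from the finiteness of [G]. *)
Definition hunit (x : R) : Prop :=
  (exists d, Rg d x) /\ exists2 y, x * y = 1 & exists d, Rg d y.

Lemma hunit_subgroup : units_subgroup hunit.
Proof.
split; first by move=> x [_ [y xy _]]; split=> //; exists y.
split.
  by split; [exists 0 | exists 1; rewrite ?mulr1 //; exists 0]; apply: grading1.
split.
  move=> x y [[d Rx] [x' xx' [d' Rx']]] [[e Ry] [y' yy' [e' Ry']]].
  split; first by exists (d + e); apply: RM.
  exists (x' * y'); first by rewrite mulrACA xx' yy' mulr1.
  by exists (d' + e'); apply: RM.
move=> x y [hx [x' xx' hx']] xy.
have <- : x' = y by rewrite -[x']mulr1 -xy mulrA [x' * x]mulrC xx' mul1r.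
by split=> //; exists x; rewrite // mulrC.
Qed.

Local Notation U := (ugrp hunit_subgroup).

Definition deg0 (u : U) : Gam := degmap Rg (uval u).

Lemma deg0_in u : Rg (deg0 u) (uval u).
Proof.
have [h _] := uvalP u.
exact: (epsilon_spec (inhabits 0) (fun g => Rg g (uval u)) h).
Qed.

Lemma uval_neq0 (u : U) : uval u <> 0.
Proof. by apply: unit_neq0; apply: uval_unit. Qed.

Lemma deg0_eq u d : Rg d (uval u) -> deg0 u = d.
Proof. by move=> h; apply: (homog_deg gr (deg0_in u) h); apply: uval_neq0. Qed.

Lemma deg_exists : exists deg : {additive U -> Gam}, deg =1 deg0.
Proof.
by apply: additive_hom_zmod => u v; apply: deg0_eq; apply: RM; apply: deg0_in.
Qed.

Variable deg : {additive U -> Gam}.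
Hypothesis degE : deg =1 deg0.

Lemma deg_in u : Rg (deg u) (uval u).
Proof. by rewrite degE; apply: deg0_in. Qed.

Lemma degmap_uval u : degmap Rg (uval u) = deg u. Proof. by rewrite degE. Qed.

Definition idem_data (p : {additive Gam -> U}) (A G : R -> Prop) : Prop :=
  [/\ A = Rsum Rg (fun g => p g = 0), G = (fun x => exists g, x = uval (p g)) &
      forall g, p (deg (p g)) = p g].

Lemma inD_idem A G : inD A G -> exists p, idem_data p A G.
Proof.
move=> h; have [f [fS fA]] := inD_grading_hom h.
have hG x : G x -> hunit x.
  move=> Gx; split; first exact: (inD_homogeneous h).
  have ux := ugrp_unit (inD_group h) Gx.
  exists x^-1; first exact: divrr.
  apply: (inD_homogeneous h); case: (inD_group h) => _ [_ [_ iG]].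
  by apply: iG Gx _; apply: divrr.
pose p0 g : U := umk hunit_subgroup (hG _ (uvalP (f g))).
have [p pE] : exists p : {additive Gam -> U}, p =1 p0.
  apply: additive_hom_zmod => a b; apply: uval_inj.
  by rewrite uvalD !umkK raddfD.
have pf g : uval (p g) = uval (f g) by rewrite pE umkK.
have pfeq g k : p g = p k <-> f g = f k.
  by split=> e; apply: uval_inj; [rewrite -!pf e | rewrite !pf e].
(* The homogeneous unit [uval (p k)] lies in the component of degree [f k] of the grading by [G], so
   [f] sends its degree in [Gam] to [f k]; this is the idempotence of [p]. *)
have f0 k : f (deg (p k)) = f k.
  apply: (Rsum_homog_inv gr (K := fun g => f g = f k) (deg_in (p k))).
    exact: uval_neq0.
  apply/fS; exists 1; last by rewrite mul1r pf.
  by case: (h) => -[_ []].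
exists p; split; last by move=> g; apply/pfeq.
- apply/predeqP => x; rewrite fA.
  have -> // : (fun g => p g = 0) = (fun g => f g = 0).
  by apply/predeqP => g; rewrite -(raddf0 p) -(raddf0 f).
- apply/predeqP => x; split=> [Gx|[g ->]]; last by rewrite pf; apply: uvalP.
  exists (deg (umk hunit_subgroup (hG x Gx))); rewrite pf.
  transitivity (uval (umk (inD_group h) Gx)) => //.
  congr uval; apply/esym; apply: (Rsum_homog_inv gr (x := x)
    (K := fun g => f g = umk (inD_group h) Gx)).
  + exact: (deg_in (umk hunit_subgroup (hG x Gx))).
  + exact: (uval_neq0 (u := umk hunit_subgroup (hG x Gx))).
  + by apply/fS; exists 1; rewrite ?mul1r //; case: (h) => -[_ []].
Qed.

(** A component of degree [g] factors as a multiple of [p g] whose cofactor has degree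
    [g - d (p g)], in the kernel of [p]. The relative form in [K] serves twice: all of [Gam]
    decomposes [R], and the kernel of another idempotent decomposes a stark subring. *)
Lemma idem_inD (K : Gam -> Prop) (p : {additive Gam -> U}) :
  K 0 -> (forall a b, K a -> K b -> K (a - b)) ->
  (forall a, K a -> K (deg (p a))) -> (forall a, K a -> p (deg (p a)) = p a) ->
  inD_in (Rsum Rg K) (Rsum Rg (fun g => K g /\ p g = 0))
         (fun x => exists2 g, K g & x = uval (p g)).
Proof.
move=> K0 KB Kdeg pp.
have KN a : K a -> K (- a) by move=> Ka; rewrite -sub0r; apply: KB.
have KD a b : K a -> K b -> K (a + b).
  by move=> Ka Kb; rewrite -[b]opprK; apply: KB => //; apply: KN.
split; [|split; [|split]].
- split; first by move=> x hx g Kg; apply: hx => -[].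
  split; first by apply: (Rsum_homog gr (d := 0)); rewrite ?raddf0 //; apply: grading1.
  split; first by move=> x y; apply: RsumB.
  move=> x y; apply: RsumM => // a b [Ka pa] [Kb pb].
  by split; [apply: KD | rewrite raddfD pa pb addr0].
- split.
    move=> _ [g Kg ->]; split.
      by apply: (Rsum_homog gr (d := deg (p g))); [apply: Kdeg | apply: deg_in].
    exists (uval (- p g)); split; last by rewrite -uvalD subrr.
    apply: (Rsum_homog gr (d := deg (- p g))); last exact: deg_in.
    by rewrite raddfN; apply: KN; apply: Kdeg.
  split; first by exists 0; rewrite ?raddf0.
  split.
    by move=> _ _ [g Kg ->] [k Kk ->]; exists (g + k); rewrite ?raddfD //; apply: KD.
  move=> _ y [g Kg ->] /mulr1_eq <-; exists (- g); first exact: KN.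
  by rewrite raddfN.
- move=> x hx; have [s [us s0 xE]] := cmp_support gr x.
  pose h g := uval (p g).
  (* The coefficient at [y] collects the components whose degree is sent to [y] by [p], divided by
     [y]. *)
  pose c y := (\sum_(g <- s | h g == y) cmp Rg x g) * y^-1.
  exists c; split; [|split].
  + move=> y; rewrite /c mulr_suml; apply: Rsum_sum => // g /eqP <-.
    case: (EM (K g)) => Kg; last by rewrite hx // mul0r; apply: Rsum0.
    apply: (Rsum_homog gr (d := g - deg (p g))).
      by split; [apply: KB => //; apply: Kdeg | rewrite raddfB /= pp // subrr].
    rewrite /h -uvalN -raddfN; apply: RM; [exact: cmp_in | exact: deg_in].
  + move=> y Jy; rewrite /c big1 ?mul0r // => g /eqP hg; apply: hx => Kg.
    by case: Jy; exists g.
  + exists (undup (map h s)); split; first exact: undup_uniq.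
      move=> y ys; rewrite /c big1_seq ?mul0r // => g /andP [/eqP hg gs].
      by case/negP: ys; rewrite mem_undup -hg map_f.
    rewrite (eq_big_seq (fun y => \sum_(g <- s | h g == y) cmp Rg x g)); last first.
      move=> y; rewrite mem_undup => /mapP [g _ ->]; rewrite /c divrK //.
      exact: uval_unit.
    rewrite (exchange_big_dep xpredT) //= {1}xE; apply: eq_big_seq => g gs.
    rewrite big_mkcond (bigD1_seq (h g)) ?undup_uniq ?mem_undup ?map_f //= eqxx.
    by rewrite big1 ?addr0 // => y; rewrite eq_sym => /negPf ->.
- move=> x c c' _ hc hc' y.
  case: (EM (exists2 g, K g & y = uval (p g))) => [[k Kk yk]|Jy]; last first.
    by case: hc => _ [-> // _]; case: hc' => _ [-> // _].
  (* Uniqueness: at a degree [d] only the summand of the group element [p d] contributes, so the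
     components of [x] determine each [b y * y]. *)
  have off (b : R -> R) g d : (forall z, Rsum Rg (fun g => K g /\ p g = 0) (b z)) ->
      K g -> p d <> p g -> cmp Rg (b (uval (p g)) * uval (p g)) d = 0.
    move=> hb Kg pd; rewrite mulrC (cmpM gr _ _ (deg_in (p g))) hb ?mulr0 // => -[_].
    by rewrite raddfB /= pp // => /eqP; rewrite subr_eq0 => /eqP.
  have on b d : grp_rep (Rsum Rg (fun g => K g /\ p g = 0))
      (fun x => exists2 g, K g & x = uval (p g)) x b ->
      p d = p k -> cmp Rg (b y * y) d = cmp Rg x d.
    move=> [hb [bJ [s [us s0 xE]]]] pd; rewrite xE cmp_sum //.
    have zero z : z != y -> cmp Rg (b z * z) d = 0.
      move=> zy; case: (EM (exists2 g, K g & z = uval (p g))) => [[g Kg zg]|Jz].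
        by rewrite zg off // pd => pkg; case/eqP: zy; rewrite zg yk pkg.
      by rewrite bJ // mul0r cmp0.
    case: (boolP (y \in s)) => ys.
      by rewrite (bigD1_seq y) //= big1 ?addr0.
    rewrite s0 // mul0r cmp0 // big1_seq // => z /andP [_ zs]; apply: zero.
    by apply: contraNneq ys => <-.
  apply: (mulIr (x := y)); first by rewrite yk uval_unit.
  apply: (cmp_inj gr) => d; case: (EM (p d = p k)) => pd; first by rewrite !on.
  by case: hc hc' => hc _ [hc' _]; rewrite yk !off.
Qed.
End Universal.

(** * Finiteness, starkness and orbits *)

(** If [1 = 2 a], then multiplying a basis vector by [2 a] shows that all its coordinates are even,
    yet one of them is [1]. An empty basis means [R = 0]. *)
Lemma order_half1 (R : comUnitRingType) (a : R) :
  is_order R -> 1 = a *+ 2 -> (0 : R) = 1.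
Proof.
move=> [n [b hb]] a1.
case: n => [|n] in b hb *.
  by have [c [-> _]] := hb 1; rewrite big_ord0.
have [c [cE _]] := hb (a * b ord0).
have [c0 [c0E c0u]] := hb (b ord0).
pose e1 := [ffun i : 'I_n.+1 => ((i == ord0) : nat)%:Z].
have h1 : c0 = e1.
  apply: c0u; rewrite big_ord_recl ffunE eqxx mulr1z big1 ?addr0 // => i _.
  by rewrite ffunE mulr0z.
have h2 : c0 = [ffun i => c i *+ 2].
  apply: c0u; rewrite -[LHS]mul1r a1 mulrnAl cE -sumrMnl.
  by apply: eq_bigr => i _; rewrite ffunE !mulr2n mulrzDr.
have /ffunP /(_ ord0) : e1 = [ffun i => c i *+ 2] by rewrite -h1.
rewrite !ffunE eqxx; lia.
Qed.

(* Elements of [G] are distinct modulo [2 R]. *)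
Lemma inD_finite (R : comUnitRingType) (A G : R -> Prop) :
  is_order R -> (0 : R) <> 1 -> inD A G -> exists s : seq R, forall x, G x -> x \in s.
Proof.
move=> ord nz h; case: (ord) => n [b hb].
have /choice [c cE] : forall x, exists c : {ffun 'I_n -> int},
    x = \sum_(i < n) b i *~ c i.
  by move=> x; have [c [cE _]] := hb x; exists c.
pose par x : {ffun 'I_n -> bool} := [ffun i => (c x i %% 2)%Z == 0].
have par_inj x y : G x -> G y -> par x = par y -> x = y.
  move=> Gx Gy /ffunP xy; apply: contrapT => nxy.
  have [z zE] : exists z, x = y + z *+ 2.
    exists (\sum_(i < n) b i *~ ((c x i - c y i) %/ 2)%Z).
    rewrite {1}(cE x) {1}(cE y) -sumrMnl -big_split; apply: eq_bigr => i _ /=.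
    rewrite mulr2n -!mulrzDr; congr (_ *~ _).
    by have := xy i; rewrite !ffunE; lia.
  have A1 : A 1 by case: (h) => -[_ []].
  (* In [x = y + 2 z] with [x] and [y] distinct, the coefficients at [x] in [A[G]] give
     [1 = 0 + 2 a]. *)
  apply/nz/(order_half1 (a := gcoef A G z x) ord).
  have := congr1 (fun t => gcoef A G t x) zE.
  rewrite mulr2n !(gcoefD h) -{1}[x]mul1r -{1}[y]mul1r !(gcoefE h) // eqxx.
  by case: eqP => // _; rewrite add0r mulr2n.
(* One representative per parity vector; vectors not attained on [G] contribute arbitrary entries,
   harmless since the list only has to cover [G]. *)
exists [seq epsilon (inhabits 0) (fun x => G x /\ par x = v)
  | v <- enum {ffun 'I_n -> bool}].
move=> x Gx; apply/mapP; exists (par x); first by rewrite mem_enum.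
have [] := epsilon_spec (inhabits (0 : R)) (fun y => G y /\ par y = par x).
  by exists x.
by move=> Gy /(par_inj _ _ Gy Gx).
Qed.

Section Main.
Variables (R : comUnitRingType) (Gam : zmodType) (Rg : Gam -> R -> Prop).
Hypotheses (ord : is_order R) (conn : connected R) (univ : universal_grading Rg).

Let gr : grading Rg. Proof. by case: univ. Qed.
Let RM d e x y : Rg d x -> Rg e y -> Rg (d + e) (x * y).
Proof. by case: gr => _ [_ [h _]]; apply: h. Qed.

Local Notation U := (ugrp (hunit_subgroup univ)).

Variable deg : {additive U -> Gam}.
Hypothesis degE : deg =1 @deg0 _ _ _ univ.

Local Notation idem := (idem_data deg).

Lemma idem_data_inD p A G : idem p A G -> inD A G.
Proof.
case=> -> -> pp; have := idem_inD degE (K := fun=> True) (p := p) I.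
have -> : Rsum Rg (fun=> True) = (fun=> True) by apply/predeqP => x; split=> // _ g [].
have -> : (fun g => True /\ p g = 0) = (fun g => p g = 0).
  by apply/predeqP => g; split=> [[]|].
have -> : (fun x => exists2 g, True & x = uval (p g)) =
    (fun x => exists g, x = uval (p g)).
  by apply/predeqP => x; split=> [[g]|[g]]; exists g.
exact.
Qed.

Lemma idem_image_finite p A G : idem p A G ->
  exists s : seq U, forall u, (u \in s) = (p (deg u) == u).
Proof.
move=> hp; have := inD_finite ord (proj1 conn) (idem_data_inD hp) => -[t tG].
exists [seq u <- pmap insub t | p (deg u) == u] => u; rewrite mem_filter andbC.
case: eqP => [pu|]; last by rewrite andbF.
rewrite andbT mem_pmap_sub; apply: tG; case: hp => _ -> _.
by exists (deg u); rewrite pu.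
Qed.

(** Translation by [p g] preserves the finite image of [p]. This is what makes the values of [p]
    roots of unity, as [homGmu] demands. *)
Lemma idem_torsion p A G : idem p A G -> forall g, exists2 n, (0 < n)%N & p g *+ n = 0.
Proof.
move=> hp g; have [s sP] := idem_image_finite hp; case: hp => _ _ pp.
apply: (@finite_torsion _ s); first by rewrite sP !raddf0.
by move=> x; rewrite !sP !raddfD /= pp => /eqP ->.
Qed.

Lemma idem_period p q A G : idem p A G -> exists2 N, (0 < N)%N &
  forall x, p (deg x) = x ->
    iter (N + N) (p \o deg \o q \o deg) x = iter N (p \o deg \o q \o deg) x.
Proof.
move=> hp; have [s sP] := idem_image_finite hp; case: hp => _ _ pp.
have [|N N0 hN] := @iter_idempotent _ (p \o deg \o q \o deg) s.
  by move=> x _; rewrite sP /= pp.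
by exists N => // x px; apply: hN; rewrite sP px.
Qed.

(** The idempotent [e] orthogonal to [q] has image of degree in the kernel of [q], so it decomposes
    [B]. It fixes [x], which therefore lies in a group that starkness makes trivial. *)
Lemma stark_injective p q A G B H : idem p A G -> idem q B H -> stark B ->
  forall x, p (deg x) = x -> q (deg x) = 0 -> x = 0.
Proof.
move=> hp [-> _ qq] st x px qx; have [N N0 hN] := idem_period q hp.
case: hp => _ _ pp.
have [e [ee qe _ ex]] := orthogonal_idempotent pp qq N0 hN.
have := idem_inD degE (K := fun g => q g = 0) (p := e).
rewrite raddf0 => /(_ erefl) h; apply: uval_inj; rewrite uval0.
apply: st (h _ _ _) _ _ => //.
  by move=> a b qa qb; rewrite raddfB qa qb subrr.
by exists (deg x); rewrite ?ex.
Qed.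

Lemma act_exists (F : {additive Gam -> U}) : exists phi : R -> R,
  {morph phi : x y / x + y} /\ forall g x, Rg g x -> phi x = uval (F g) * x.
Proof.
have /choice [S hS] := cmp_support gr.
pose phi x := \sum_(g <- S x) uval (F g) * cmp Rg x g.
have phiE x t : uniq t -> (forall g, g \notin t -> cmp Rg x g = 0) ->
    phi x = \sum_(g <- t) uval (F g) * cmp Rg x g.
  move=> ut ht; have [us hs _] := hS x.
  have z s : (forall g, g \notin s -> cmp Rg x g = 0) ->
      forall g, g \notin s -> uval (F g) * cmp Rg x g = 0.
    by move=> h g /h ->; rewrite mulr0.
  transitivity (\sum_(g <- undup (S x ++ t)) uval (F g) * cmp Rg x g).
    apply/esym/sum_support; rewrite ?undup_uniq //; last exact: z.
    by move=> g; rewrite mem_undup mem_cat => ->.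
  apply: sum_support; rewrite ?undup_uniq //; last exact: z.
  by move=> g; rewrite mem_undup mem_cat orbC => ->.
exists phi; split=> [x y|g x Rx].
  pose t := undup (S x ++ S y).
  have ht z : z = x \/ z = y -> forall g, g \notin t -> cmp Rg z g = 0.
    move=> zxy g; rewrite mem_undup mem_cat negb_or => /andP [gx gy].
    by case: zxy => ->; [have [_ -> //] := hS x | have [_ -> //] := hS y].
  have ut : uniq t by apply: undup_uniq.
  rewrite !(@phiE _ t) //; try by apply: ht; auto.
    by rewrite -big_split; apply: eq_bigr => g _; rewrite cmpD // mulrDr.
  by move=> g gt; rewrite cmpD // !ht ?addr0; auto.
rewrite (@phiE _ [:: g]) // => [|k]; first by rewrite big_seq1 (cmp_homog gr _ Rx) eqxx.
by rewrite inE (cmp_homog gr _ Rx) => /negPf ->.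
Qed.

(** * The ring endomorphism of [R] attached to [1 + F] *)

Section Action.
Variables (F : {additive Gam -> U}) (phi : R -> R).
Hypotheses (phiD : {morph phi : x y / x + y})
  (phiE : forall g x, Rg g x -> phi x = uval (F g) * x).

Let phi0 : phi 0 = 0. Proof. by rewrite (phiE (g := 0)) ?mulr0 //; case: gr. Qed.

Lemma act_relE x y : act_rel Rg (fun g => uval (F g)) x y <-> y = phi x.
Proof.
split=> [[s [c [us Rc c0 -> ->]]]|->].
  by rewrite (big_morph phi phiD phi0); apply: eq_bigr => g _; rewrite -phiE.
have [s [us s0 xE]] := cmp_support gr x; exists s, (cmp Rg x); split=> //.
  by move=> g; apply: cmp_in.
rewrite {1}xE (big_morph phi phiD phi0); apply: eq_bigr => g _.
by rewrite -phiE //; apply: cmp_in.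
Qed.

Lemma actM : {morph phi : x y / x * y}.
Proof.
move=> x y; apply: (additive_ext gr (phi := fun x => phi (x * y))
    (psi := fun x => phi x * phi y)) => [a b|a b|g a Ra].
- by rewrite mulrDl phiD.
- by rewrite phiD mulrDl.
apply: (additive_ext gr (phi := fun y => phi (a * y))
    (psi := fun y => phi a * phi y)) => [b c|b c|k b Rb].
- by rewrite mulrDr phiD.
- by rewrite phiD mulrDr.
rewrite (phiE Ra) (phiE Rb) (phiE (RM Ra Rb)) raddfD uvalD.
by rewrite mulrACA.
Qed.

Lemma act1 : phi 1 = 1.
Proof. by rewrite (phiE (grading1 gr)) raddf0 uval0 mulr1. Qed.

Lemma act_homog g x : Rg g x -> Rg (g + deg (F g)) (phi x).
Proof. by move=> Rx; rewrite (phiE Rx) addrC; apply: RM => //; apply: deg_in. Qed.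

Lemma act_uval u : phi (uval u) = uval (F (deg u) + u).
Proof. by rewrite (phiE (deg_in degE u)) uvalD. Qed.

Lemma act_sub (K L : Gam -> Prop) :
  (forall g, K g -> L (g + deg (F g))) ->
  forall x, Rsum Rg K x -> Rsum Rg L (phi x).
Proof.
move=> KL; apply: Rsum_ind => //; first by rewrite phi0; apply: Rsum0.
  by move=> x y hx hy; rewrite phiD; apply: RsumD.
move=> g x Kg Rx; apply: (Rsum_homog gr (d := g + deg (F g))); first exact: KL.
exact: act_homog.
Qed.
End Action.

(** The condition on [F] and [F'] is [(1 + F') (1 + F) = 1]: the first map moves degree [g] to
    [g + d (F g)], where [F'] is then evaluated. *)
Lemma act_cancel (F F' : {additive Gam -> U}) (phi phi' : R -> R) :
  {morph phi : x y / x + y} -> (forall g x, Rg g x -> phi x = uval (F g) * x) ->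
  {morph phi' : x y / x + y} -> (forall g x, Rg g x -> phi' x = uval (F' g) * x) ->
  (forall g, F g + F' g + F' (deg (F g)) = 0) -> cancel phi phi'.
Proof.
move=> phiD phiE phiD' phiE' FF; apply: (additive_ext gr (psi := id)) => //.
  by move=> x y; rewrite phiD phiD'.
move=> g x Rx; rewrite (phiE' _ _ (act_homog phiE Rx)) (phiE _ _ Rx) mulrA -uvalD.
by rewrite raddfD addrC addrA FF uval0 mul1r.
Qed.

(* [1 + F] with [F = r - p - q + q p] has inverse [1 + p q - r] and conjugates
   [p] to [q]. *)
Lemma idem_orbit p q (r : {additive Gam -> U}) A G B H : idem p A G -> idem q B H ->
  (forall g, exists2 n, (0 < n)%N & r g *+ n = 0) ->
  (forall a, p (deg (r a)) = p a) -> (forall a, q (deg (r a)) = r a) ->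
  (forall a, r (deg (q a)) = q a) -> (forall a, r (deg (p a)) = r a) ->
  (forall a, r (deg (r a)) = r a) ->
  same_orbit Rg A G B H /\ exists phi, ring_iso_on A B phi /\ group_iso_on G H phi.
Proof.
move=> hp hq rt pr qr rq rp rr.
have [pt qt] := (idem_torsion hp, idem_torsion hq).
case: hp hq => [-> -> pp] [-> -> qq].
pose F : {additive Gam -> U} := (r \- p) \- (q \- (q \o deg \o p)).
pose F' : {additive Gam -> U} := (p \o deg \o q) \- r.
have FE g : F g = r g - p g - (q g - q (deg (p g))) by [].
have FE' g : F' g = p (deg (q g)) - r g by [].
clearbody F F'.
have FF' g : F g + F' g + F' (deg (F g)) = 0.
  (* The product [(p q - r) (r - p - q + q p)], reduced by [p r = p], [q r = r], [r q = q],
     [r p = r] and the idempotence of [p], [q], [r]. *)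
  have -> : F' (deg (F g)) = p g - p (deg (q g)) + (q g - q (deg (p g))).
    rewrite FE' FE !raddfB /= !(pp, qq, pr, qr, rq, rp, rr).
    by rewrite !opprK addNr add0r [- p _ + _]addrC subrKA.
  rewrite FE FE' addrC; apply/eqP; rewrite addr_eq0 opprD !opprB.
  by rewrite -[X in _ == X]addrA subrKA addrC.
have F'F g : F' g + F g + F (deg (F' g)) = 0.
  have -> : F (deg (F' g)) = (q g - q (deg (p g))) - (p (deg (q g)) - p g).
    rewrite FE FE' !raddfB /= !(pp, qq, pr, qr, rq, rp, rr).
    by rewrite !opprK [- q _ + r g]addrC subrKA addrAC subrKA.
  rewrite FE FE' -[r g - p g - _]addrA subrKA.
  by rewrite [p _ + (_ - _)]addrA subrKA subrr.
have [phi [phiD phiE]] := act_exists F.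
have [phi' [phiD' phiE']] := act_exists F'.
have K := act_cancel phiD phiE phiD' phiE' FF'.
have K' := act_cancel phiD' phiE' phiD phiE F'F.
(* If [p g = 0], then [r g = r (d (p g)) = 0], so [F g = - q g] and the new degree [g - d (q g)]
   lies in the kernel of [q]. *)
have AB x : Rsum Rg (fun g => p g = 0) x -> Rsum Rg (fun g => q g = 0) (phi x).
  apply: (act_sub phiD phiE) => g pg.
  have rg : r g = 0 by rewrite -rp pg !raddf0.
  by rewrite FE rg pg !raddf0 !addr0 add0r !raddfD !raddfN /= qq subrr.
have BA x : Rsum Rg (fun g => q g = 0) x -> Rsum Rg (fun g => p g = 0) (phi' x).
  apply: (act_sub phiD' phiE') => g qg.
  by rewrite FE' qg !raddf0 sub0r !raddfD !raddfN /= pr subrr.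
have GH x : (exists g, x = uval (p g)) -> exists g, phi x = uval (q g).
  (* At the degree of [p g] the two terms in [q] cancel, so [phi] sends [p g] to [r g], an element
     of [im q]. *)
  move=> [g ->]; exists (deg (r g)); rewrite (act_uval phiE) FE pp rp.
  by rewrite subrr subr0 subrK qr.
have HG x : (exists g, x = uval (q g)) -> exists g, phi' x = uval (p g).
  move=> [g ->]; exists (deg (q g)); rewrite (act_uval phiE') FE' qq rq.
  by rewrite subrK.
have rootE (u : U) : (exists2 n, (0 < n)%N & u *+ n = 0) -> Defs.root_of_unity (uval u).
  by move=> [n n0 un]; exists n; split=> //; rewrite -uvalMn un.
have torD (u v : U) : (exists2 n, (0 < n)%N & u *+ n = 0) ->
    (exists2 n, (0 < n)%N & v *+ n = 0) -> exists2 n, (0 < n)%N & (u - v) *+ n = 0.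
  move=> [n n0 un] [m m0 vm]; exists (n * m)%N; first by rewrite muln_gt0 n0.
  by rewrite mulrnBl mulrnA un mul0rn mulnC mulrnA vm mul0rn subrr.
have homF : homGmu (fun g => uval (F g)).
  split=> [g|a b]; last by rewrite raddfD uvalD.
  by apply: rootE; rewrite FE; apply: (torD); apply: (torD).
have homF' : homGmu (fun g => uval (F' g)).
  split=> [g|a b]; last by rewrite raddfD uvalD.
  by apply: (rootE); rewrite FE'; apply: (torD).
split.
  exists (fun g => uval (F g)); split; [split=> //|split].
  - exists (1, fun g => uval (F' g)); split=> //.
    split; split; rewrite /= ?mulr1 // => g.
      rewrite /= !expr1z (degmap_uval degE) -!uvalD.
      by rewrite F'F.
    rewrite /= !expr1z (degmap_uval degE) -!uvalD.
    by rewrite FF'.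
  - move=> y; split=> [[x [hx /(act_relE phiD phiE) ->]]|hy]; first exact: AB.
    exists (phi' y); split; first exact: BA.
    by apply/(act_relE phiD phiE); rewrite K'.
  - move=> y; split=> [[x [hx /(act_relE phiD phiE) ->]]|hy]; first exact: GH.
    exists (phi' y); split; first exact: HG.
    by apply/(act_relE phiD phiE); rewrite K'.
exists phi; split.
  split=> //; split; first by move=> x y _ _; apply: (can_inj K).
  split; first by move=> y hy; exists (phi' y); split; [apply: BA | apply: K'].
  split; first by move=> x y _ _; apply: phiD.
  by split; [move=> x y _ _; apply: (actM phiD phiE) | apply: (act1 phiE)].
split=> //; split; first by move=> x y _ _; apply: (can_inj K).
split; first by move=> y hy; exists (phi' y); split; [apply: HG | apply: K'].
by move=> x y _ _; apply: (actM phiD phiE).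
Qed.
End Main.

(** * Comparison of two stark decompositions *)

Theorem theorem6p10 (R : comUnitRingType) (Gam : zmodType)
  (Rg : Gam -> R -> Prop) (A G B H : R -> Prop) :
  is_order R -> reduced R -> connected R ->
  universal_grading Rg ->
  inD A G -> inD B H -> stark A -> stark B ->
  [/\ (exists phi : R -> R, ring_iso_on A B phi),
      (exists psi : R -> R, group_iso_on G H psi),
      [/\ inD A G, inD A H, inD B G & inD B H] &
      [/\ same_orbit Rg A G A H, same_orbit Rg A G B G & same_orbit Rg A G B H]].
Proof.
move=> ord _ conn univ hAG hBH sA sB.
have [deg degE] := deg_exists univ conn.
have [p hp] := inD_idem conn degE hAG; have [q hq] := inD_idem conn degE hBH.
have [_ _ pp] := hp; have [_ _ qq] := hq.
have injp := stark_injective ord conn degE hp hq sB.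
have injq := stark_injective ord conn degE hq hp sA.
have [N N0 hN] := idem_period ord conn degE q hp.
have [N' N0' hN'] := idem_period ord conn degE p hq.
have [r [pr qr rq rp rr]] := connecting_idempotent pp qq N0 hN injp injq.
have [r' [qr' pr' rp' rq' rr']] := connecting_idempotent qq pp N0' hN' injq injp.
(* [r p = r] and [p r = p] give [r] the kernel of [p]; [r q = q] and [q r = r] give it the image of
   [q]. Symmetrically [r'] has the kernel of [q] and the image of [p]. *)
have hr : idem_data deg r A H.
  case: (hp) (hq) => [-> _ _] [_ -> _]; split=> //.
    congr Rsum; apply/predeqP => g; split=> e; first by rewrite -rp e !raddf0.
    by rewrite -pr e !raddf0.
  apply/predeqP => x; split=> -[g ->]; first by exists (deg (q g)); rewrite rq.
  by exists (deg (r g)); rewrite qr.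
have hr' : idem_data deg r' B G.
  case: (hp) (hq) => [_ -> _] [-> _ _]; split=> //.
    congr Rsum; apply/predeqP => g; split=> e; first by rewrite -rq' e !raddf0.
    by rewrite -qr' e !raddf0.
  apply/predeqP => x; split=> -[g ->]; first by exists (deg (p g)); rewrite rp'.
  by exists (deg (r' g)); rewrite pr'.
have tr := idem_torsion ord conn degE hr; have tp := idem_torsion ord conn degE hp.
(* The connecting idempotent needs the kernel of the source and the image of the target: [r] from
   [p] to [q] and from [p] to [r], but [p] itself from [p] to [r'], as these two share their
   image. *)
have [oBH [phi [phiA phiG]]] := idem_orbit ord conn degE hp hq tr pr qr rq rp rr.
have [oAH _] := idem_orbit ord conn degE hp hr tr pr rr rr rp rr.
have [oBG _] := idem_orbit ord conn degE hp hr' tp pp rp' pr' pp pp.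
split; [by exists phi | by exists phi | | by split].
by split=> //; [apply: idem_data_inD hr | apply: idem_data_inD hr'].
Qed.
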